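(* There exists a $\mathrm{HyperQPTL}$ sentence $\varphi$ that is satisfiable (i.e., some nonempty set of traces is a model of $\varphi$) and such that every model $T$ of $\varphi$ has cardinality $\mathfrak{c}$, the cardinality of the continuum.
   Context: Let $\mathrm{AP}$ be a nonempty finite set of atomic propositions. A trace over $\mathrm{AP}$ is an infinite word $t=t(0)t(1)\cdots$ over the alphabet $2^{\mathrm{AP}}$. Let $\mathcal{V}$ be a countable set of trace variables. $\mathrm{HyperQPTL}$ formulas are given by the grammar $\phi ::= \exists \pi.\,\phi \mid \forall \pi.\,\phi \mid \exists q.\,\phi \mid \forall q.\,\phi \mid \psi$, $\psi ::= p_\pi \mid q \mid \neg\psi \mid \psi\vee\psi \mid \mathbf{X}\psi \mid \mathbf{F}\psi$, with $p,q\in\mathrm{AP}$ and $\pi\in\mathcal{V}$ (other Boolean connectives and $\mathbf{G}$, $\mathbf{U}$ are derived). A sentence is a formula in which every $p_\pi$ lies in the scope of a quantifier binding $\pi$ and every unlabeled $q$ lies in the scope of a quantifier binding $q$. For a trace $t$ over $\mathrm{AP}$ and a trace $t_q$ over $\{q\}$, $t[q\mapsto t_q]$ is the trace obtained from $t$ by replacing, at every position $n$, the truth value of $q$ by that in $t_q(n)$; for a set $T$ of traces, $T[q\mapsto t_q]=\{t[q\mapsto t_q]\mid t\in T\}$. For a set $T$ of traces, a partial map $\Pi:\mathcal{V}\to(2^{\mathrm{AP}})^\omega$ and $i\in\mathbb{N}$: $T,\Pi,i\models p_\pi$ iff $p\in\Pi(\pi)(i)$; $T,\Pi,i\models q$ iff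 $q\in t(i)$ for all $t\in T$; negation and disjunction are as usual; $T,\Pi,i\models\mathbf{X}\psi$ iff $T,\Pi,i+1\models\psi$; $T,\Pi,i\models\mathbf{F}\psi$ iff $T,\Pi,i'\models\psi$ for some $i'\ge i$; $T,\Pi,i\models\exists\pi.\phi$ (resp. $\forall\pi.\phi$) iff for some (resp. all) $t\in T$, $T,\Pi[\pi\mapsto t],i\models\phi$; $T,\Pi,i\models\exists q.\phi$ (resp. $\forall q.\phi$) iff for some (resp. all) traces $t_q\in(2^{\{q\}})^\omega$, $T[q\mapsto t_q],\Pi,i\models\phi$. A nonempty set $T$ of traces is a model of a sentence $\phi$ ($T\models\phi$) if $T,\Pi_\emptyset,0\models\phi$ with $\Pi_\emptyset$ the empty assignment.
   Formalization: Proved for every finite AP with at least two propositions and every nonempty countable set of trace variables; with a single proposition (or no trace variable) every satisfiable sentence has a countable model, so the claim fails there. *)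

(* Defs.v *)
From HB Require Import structures.
From mathcomp Require Import all_boot all_order all_algebra.
From mathcomp Require Import boolp classical_sets functions cardinality reals.

Set Implicit Arguments.
Unset Strict Implicit.
Unset Printing Implicit Defensive.

Local Open Scope classical_set_scope.

Definition trace (AP : finType) : Type := nat -> {set AP}.

Section Syntax.
Variables (AP : finType) (V : countType).

Inductive body : Type :=
  | LAtom of AP & V    (* p_pi *)
  | UAtom of AP        (* q, without trace label *)
  | Neg of body
  | Or of body & body
  | Next of body
  | Eventually of body.

Inductive formula : Type :=
  | ExTrace of V & formula
  | AllTrace of V & formula
  | ExProp of AP & formula
  | AllProp of AP & formula
  | Body of body.

(* [vs] and [qs] are the trace variables and the propositions bound by the
   enclosing quantifiers. *)
Fixpoint closed_body (vs : seq V) (qs : seq AP) (psi : body) : bool :=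
  match psi with
  | LAtom _ v => v \in vs
  | UAtom q => q \in qs
  | Neg psi1 => closed_body vs qs psi1
  | Or psi1 psi2 => closed_body vs qs psi1 && closed_body vs qs psi2
  | Next psi1 => closed_body vs qs psi1
  | Eventually psi1 => closed_body vs qs psi1
  end.

Fixpoint closed_formula (vs : seq V) (qs : seq AP) (phi : formula) : bool :=
  match phi with
  | ExTrace v phi1 => closed_formula (v :: vs) qs phi1
  | AllTrace v phi1 => closed_formula (v :: vs) qs phi1
  | ExProp q phi1 => closed_formula vs (q :: qs) phi1
  | AllProp q phi1 => closed_formula vs (q :: qs) phi1
  | Body psi => closed_body vs qs psi
  end.

Definition is_sentence (phi : formula) : bool := closed_formula [::] [::] phi.

End Syntax.

Section Semantics.
Variables (AP : finType) (V : countType).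

(* Traces over {q}, viewed as traces over AP all of whose letters are subsets
   of {q}. *)
Definition prop_trace (q : AP) : set (trace AP) :=
  [set tq : trace AP | forall n, tq n \subset [set q]%SET].

Definition replace (q : AP) (tq t : trace AP) : trace AP :=
  fun n => [set a | if a == q then q \in tq n else a \in t n]%SET.

Definition replace_set (q : AP) (tq : trace AP) (T : set (trace AP)) :
  set (trace AP) := replace q tq @` T.

Definition assignment : Type := V -> option (trace AP).

Definition empty_assignment : assignment := fun=> None.

Definition update (Pi : assignment) (v : V) (t : trace AP) : assignment :=
  fun w => if w == v then Some t else Pi w.

(* The value of p_pi for pi outside the domain of Pi is a convention; it never
   matters for sentences. *)
Fixpoint sat_body (T : set (trace AP)) (Pi : assignment) (i : nat)
    (psi : body AP V) : Prop :=
  match psi with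
  | LAtom p v => if Pi v is Some t then p \in t i else False
  | UAtom q => forall t, T t -> q \in t i
  | Neg psi1 => ~ sat_body T Pi i psi1
  | Or psi1 psi2 => sat_body T Pi i psi1 \/ sat_body T Pi i psi2
  | Next psi1 => sat_body T Pi i.+1 psi1
  | Eventually psi1 => exists2 j, i <= j & sat_body T Pi j psi1
  end.

Fixpoint sat (T : set (trace AP)) (Pi : assignment) (i : nat)
    (phi : formula AP V) : Prop :=
  match phi with
  | ExTrace v phi1 => exists2 t, T t & sat T (update Pi v t) i phi1
  | AllTrace v phi1 => forall t, T t -> sat T (update Pi v t) i phi1
  | ExProp q phi1 =>
      exists2 tq, prop_trace q tq & sat (replace_set q tq T) Pi i phi1
  | AllProp q phi1 =>
      forall tq, prop_trace q tq -> sat (replace_set q tq T) Pi i phi1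
  | Body psi => sat_body T Pi i psi
  end.

Definition is_model (T : set (trace AP)) (phi : formula AP V) : Prop :=
  T !=set0 /\ sat T empty_assignment 0 phi.

Definition satisfiable (phi : formula AP V) : Prop :=
  exists T : set (trace AP), is_model T phi.

End Semantics.

(* Main.v *)
Require Import Defs.
From HB Require Import structures.
From mathcomp Require Import all_boot all_order all_algebra.
From mathcomp Require Import boolp classical_sets functions cardinality reals.
From mathcomp Require Import lra.

(** The sentence is [forall q, exists pi, G (q <-> p_pi)] for two distinct
    propositions [p] and [q].  Replacing [q] makes its value uniform over [T]
    and leaves [p] untouched, so the sentence says that every sequence of truth
    values is the [p]-projection of some trace of [T].  Hence a model maps onto
    the Cantor space; conversely, the set of all traces embeds in it. *)

Set Implicit Arguments.
Unset Strict Implicit.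
Unset Printing Implicit Defensive.

Import Order.TTheory GRing.Theory Num.Theory.

Local Open Scope classical_set_scope.

Lemma inj_card_leT T U (f : T -> U) :
  injective f -> ([set: T] #<= [set: U])%card.
Proof.
move=> f_inj; apply/card_subP; exists (range f) => //.
by apply: inj_card_eq => x y _ _; exact: f_inj.
Qed.

Section CantorCardinality.
Local Open Scope ring_scope.
Variable R : realType.

(** A real is determined by its Dedekind cut, recorded as a bit sequence along an enumeration of the
    rationals; a rational between two reals separates their cuts. *)
Lemma card_le_real_cantor : ([set: R] #<= [set: nat -> bool])%card.
Proof.
pose cut (x : R) n := if unpickle n is Some q then ratr q < x else false.
apply: (@inj_card_leT _ _ cut) => x y exy.
wlog ltxy : x y exy / x < y.
  by move=> wlg; have [/wlg->|/wlg->|] := ltgtP x y.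
have [q] := rat_in_itvoo ltxy; rewrite in_itv/= => /andP[xq qy].
have := congr1 (@^~ (pickle q)) exy.
by rewrite /cut pickleK qy ltNge (ltW xq).
Qed.

(** Digits 0 and 1 are read in base 3, not 2, so that a digit 1 outweighs all later digits together;
    in base 2, the sequences 0111... and 1000... would have the same sum. *)
Let psum (a : nat -> bool) n : R := \sum_(k < n) (a k)%:R / 3 ^+ k.

Let psumS a n : psum a n.+1 = psum a n + (a n)%:R / 3 ^+ n.
Proof. by rewrite /psum big_ord_recr. Qed.

Let inv_exp3_gt0 n : 0 < (3 ^+ n)^-1 :> R.
Proof. by rewrite invr_gt0 exprn_gt0. Qed.

Let psum_le a m n : (m <= n)%N -> psum a m <= psum a n.
Proof.
move/subnK => <-; elim: (n - m)%N => //= d IH.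
rewrite addSn psumS (le_trans IH)// lerDl mulr_ge0 ?ler0n//.
exact/ltW/inv_exp3_gt0.
Qed.

(* [3/2 * 3^-n] is the sum of the full geometric tail from [n] on. *)
Let psum_tail_le a m n :
  (m <= n)%N -> psum a n + 3 / 2 / 3 ^+ n <= psum a m + 3 / 2 / 3 ^+ m.
Proof.
move/subnK => <-; elim: (n - m)%N => //= d IH.
rewrite addSn psumS; apply: le_trans IH.
rewrite exprS invfM; move: (inv_exp3_gt0 (d + m)).
set u := (3 ^+ _)^-1 => u0; case: (a _) => /=; lra.
Qed.

Let psum_ub a m n : psum a n <= psum a m + 3 / 2 / 3 ^+ m.
Proof.
have u0 k : 0 < 3 / 2 / 3 ^+ k :> R by apply: mulr_gt0 => //; exact: divr_gt0.
case: (leqP m n) => [mn|/ltnW nm].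
  by apply: le_trans (psum_tail_le a mn); rewrite lerDl ltW.
by rewrite (le_trans (psum_le a nm))// lerDl ltW.
Qed.

(** The first index [m] at which two sequences differ decides the order of their sums. *)
Lemma card_le_cantor_real : ([set: nat -> bool] #<= [set: R])%card.
Proof.
pose f a := sup (range (psum a)).
have has_ub a : has_ubound (range (psum a)).
  by exists (psum a 0 + 3 / 2 / 3 ^+ 0) => _ [n _ <-].
apply: (@inj_card_leT _ _ f) => a b eab.
apply: contrapT => neq.
have /ex_minnP[m nm mP] : exists n, a n != b n.
  apply: contrapT => /forallNP H; apply: neq; apply/funext => n.
  by apply/eqP; move/negP: (H n); rewrite negbK.
have agree k : (k < m)%N -> a k = b k.
  by move=> km; apply/eqP; apply: contraTT km => /mP; rewrite -leqNgt.
wlog am : a b eab {neq mP} nm agree / a m = false.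
  move=> wlg; case E : (a m); last exact: (wlg a b).
  apply: (wlg b a) => //; first by rewrite eq_sym.
    by move=> k /agree.
  by move: nm; rewrite E; case: (b m).
have bm : b m by move: nm; rewrite am; case: (b m).
have eqm : psum a m = psum b m.
  by apply: eq_bigr => k _; rewrite agree.
(* Digit [m] of [a] is 0, so its tail only starts at [m.+1] and adds at most half of [3 ^- m], the
   amount that [b] gains at [m]. *)
have le_fa : f a <= psum a m + 3 / 2 / 3 ^+ m.+1.
  apply: ge_sup; first by exists (psum a 0), 0%N.
  by move=> _ [n _ <-]; rewrite (le_trans (psum_ub a m.+1 n))// psumS am mul0r addr0.
have ge_fb : psum b m + (3 ^+ m)^-1 <= f b.
  by apply: ub_le_sup => //; exists m.+1 => //; rewrite psumS bm mul1r.
move: le_fa ge_fb; rewrite eab eqm exprS invfM.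
by move: (inv_exp3_gt0 m); set u := (3 ^+ _)^-1 => u0 *; lra.
Qed.

End CantorCardinality.

(** A trace is a table of bits indexed by the countably many pairs of a position and a
    proposition. *)
Lemma card_le_trace_cantor (AP : finType) :
  ([set: trace AP] #<= [set: nat -> bool])%card.
Proof.
pose code (t : trace AP) n :=
  if unpickle n is Some (i, p) then p \in t i else false.
apply: (@inj_card_leT _ _ code) => s t est; apply/funext => i.
apply/setP => p; have := congr1 (@^~ (pickle (i, p))) est.
by rewrite /code pickleK.
Qed.

Definition proj (AP : finType) (p : AP) (t : trace AP) : nat -> bool :=
  fun i => p \in t i.

(** Used in two roles: as a preimage of [b] under [proj p], and, with [q] for [p], as a value for
    the quantifier over [q], whose letters must be subsets of [{q}]. *)
Definition single_trace (AP : finType) (p : AP) (b : nat -> bool) : trace AP :=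
  fun n => [set a | (a == p) && b n]%SET.

Lemma single_traceK (AP : finType) (p : AP) :
  cancel (single_trace p) (proj p).
Proof. by move=> b; apply/funext => n; rewrite /proj inE eqxx. Qed.

Section EveryProjection.
Variables (AP : finType) (V : countType) (p q : AP) (v : V).
Hypothesis neq_pq : p != q.

(** [G] is unfolded as not-[F]-not; the two disjuncts are the negations of the two implications that
    make up the equivalence. *)
Definition every_projection : formula AP V :=
  AllProp q (ExTrace v (Body (Neg (Eventually
    (Or (Neg (Or (Neg (UAtom V q)) (LAtom p v)))
        (Neg (Or (Neg (LAtom p v)) (UAtom V q)))))))).

Lemma sat_every_projection (T : set (trace AP)) Pi : T !=set0 ->
  sat T Pi 0 every_projection <-> proj p @` T = setT.
Proof.
move=> [t0 Tt0] /=.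
have projE tq t : proj p (replace q tq t) = proj p t.
  by apply/funext => i; rewrite /proj inE (negbTE neq_pq).
(* After the replacement all traces agree on [q], so the unlabeled atom just reads [tq]; the trace
   [t0] keeps the universal statement from being vacuous. *)
have qE tq i : (forall t, replace_set q tq T t -> q \in t i) <-> q \in tq i.
  split=> [/(_ _ (ex_intro2 _ _ t0 Tt0 erefl))|qi _ [t _ <-]].
    by rewrite inE eqxx.
  by rewrite inE eqxx.
have updE t : update Pi v t v = Some t by rewrite /update eqxx.
split=> [sat_T|proj_T tq _].
  apply/seteqP; split=> // b _.
  (* Instantiating the quantified [q] with [b] itself forces some trace to have [p]-projection
     [b]. *)
  pose tq := single_trace q b.
  have qtq n : (q \in tq n) = b n by rewrite inE eqxx.
  have [n|_ [t Tt <-]] := sat_T tq.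
    by apply/fintype.subsetP => a; rewrite !inE => /andP[].
  (* The trace bound to [v] lies in the modified set, but its original [t] in [T] has the same
     [p]-projection. Any disagreement at [i] would make one of the disjuncts under [F] true. *)
  rewrite updE => nF; exists t => //; rewrite -(projE tq); apply/funext => i.
  apply/idP/idP => H; apply: contrapT => nH; apply: nF; exists i => //.
    right=> -[|/qE]; first by apply.
    by rewrite qtq.
  by left=> -[|//]; apply; apply/qE; rewrite qtq.
(* Conversely, a trace of [T] whose [p]-projection is the sequence given by [tq] is a witness once
   its [q] is replaced. *)
have : setT (proj q tq) by [].
rewrite -proj_T => -[t Tt pt]; exists (replace q tq t); first by exists t.
have mE i : (p \in replace q tq t i) = (q \in tq i).
  by rewrite -/(proj p _ i) projE pt.
rewrite updE => -[i _]; rewrite mE; case => H; apply: H.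
  by case: (boolP (q \in tq i)) => [|/negP]; [right|left=> /qE].
by case: (boolP (q \in tq i)) => [|/negP]; [right; apply/qE|left].
Qed.

End EveryProjection.

Theorem theorem1 (R : realType) (AP : finType) (V : countType)
    (hAP : 2 <= #|AP|) (hV : [set: V] !=set0) :
  exists phi : formula AP V,
    [/\ is_sentence phi,
        satisfiable phi &
        forall T : set (trace AP), is_model T phi -> (T #= [set: R])%card].
Proof.
have [v _] := hV; have [p [q [_ _ neq_pq]]] := card_gt1P hAP.
exists (every_projection p q v); split.
- by rewrite /is_sentence/= !inE !eqxx.
- have nonempty : [set: trace AP] !=set0 by exists (single_trace p xpred0).
  exists setT; split=> //; apply/sat_every_projection => //.
  apply/seteqP; split=> // b _.
  by exists (single_trace p b) => //; exact: single_traceK.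
- move=> T [T0 /(sat_every_projection v neq_pq _ T0) proj_T].
  apply: Cantor_Bernstein.
    apply: card_le_trans (card_leT T) _.
    exact: card_le_trans (card_le_trace_cantor AP) (card_le_cantor_real R).
  apply: card_le_trans (card_le_real_cantor R) _.
  by rewrite -proj_T; exact: card_image_le.
Qed.
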